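(* For every parameter vector $\bm{\theta}\in\mathbb{R}^D$, the gradient of the trace of the squared loss Hessian with respect to the input-to-hidden parameters $\bm{w}$ is $$\frac{\partial\,\mathrm{tr}(\bm{H}_L(\bm{\theta})^2)}{\partial\bm{w}}=2\sum_{i=1}^I\sum_{j=1}^I\Big(\bm{h}(\bm{x}_i)\otimes\sum_{a\in\{\Phi,\Psi,\Omega\}}\bm{\mathcal{W}}_{ij}^a\Big)\in\mathbb{R}^{(M+1)N},\qquad \bm{\mathcal{W}}_{ij}^a=\bm{\mathcal{A}}_{ij}^a+\bm{\mathcal{B}}_{ij}^a\in\mathbb{R}^N,$$ where $$\bm{\mathcal{A}}_{ij}^\Phi=(1+\bm{x}_i^\top\bm{x}_j)^2\bm{G}^\Phi_{ij}(\bm{o}_i\otimes\bm{o}_j),\qquad \bm{\mathcal{A}}_{ij}^\Psi=2(1+\bm{x}_i^\top\bm{x}_j)\bm{G}^\Psi_{ij}(\bm{o}_i\otimes\bm{o}_j),$$ $$\bm{\mathcal{A}}_{ij}^\Omega=(1+\bm{f}(\bm{y}_i)^\top\bm{f}(\bm{y}_j))^2s''(z_i)s'(z_j)\bm{F}'(\bm{y}_i)\widetilde{\bm{V}}^\top,$$ $$\bm{\mathcal{B}}_{ij}^\Phi=(1+\bm{x}_i^\top\bm{x}_j)^2\bm{F}'(\bm{y}_i)\widetilde{\bm{V}}^\top\bm{s}^{\prime\prime/\prime}(z_i)^\top\bm{\Phi}_{ij}\bm{o}_j,\qquad \bm{\mathcal{B}}_{ij}^\Psi=2(1+\bm{x}_i^\top\bm{x}_j)\bm{F}'(\bm{y}_i)\widetilde{\bm{V}}^\top\bm{s}^{\prime\prime/\prime}(z_i)^\top\bm{\Psi}_{ij}\bm{o}_j,$$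 $$\bm{\mathcal{B}}_{ij}^\Omega=2s'(z_i)s'(z_j)(1+\bm{f}(\bm{y}_i)^\top\bm{f}(\bm{y}_j))\bm{F}'(\bm{y}_i)\bm{f}(\bm{y}_j).$$ Here $\bm{G}^\Phi_{ij}=[\bm{\mathfrak{a}}^\Phi_{ij}\ \bm{\mathfrak{b}}^\Phi_{ij}\ \bm{\mathfrak{c}}^\Phi_{ij}\ \bm{\mathfrak{d}}^\Phi_{ij}]\in\mathbb{R}^{N\times4}$ with $$\bm{\mathfrak{a}}^\Phi_{ij}=2(\bm{\Phi}_{ij})_{11}^{1/2}\bm{F}''(\bm{y}_i)\bm{F}'(\bm{y}_j)\widetilde{\bm{V}}^{\odot2\top},\qquad \bm{\mathfrak{b}}^\Phi_{ij}=2\bm{F}'(\bm{y}_i)\bm{F}''(\bm{y}_i)\bm{F}''(\bm{y}_j)\widetilde{\bm{V}}^{\odot3\top},$$ $$\bm{\mathfrak{c}}^\Phi_{ij}=\bm{F}'''(\bm{y}_i)\bm{F}'(\bm{y}_j)^2\widetilde{\bm{V}}^{\odot3\top},\qquad \bm{\mathfrak{d}}^\Phi_{ij}=\bm{F}'''(\bm{y}_i)\bm{F}''(\bm{y}_j)\widetilde{\bm{V}}^{\odot2\top},$$ and $\bm{G}^\Psi_{ij}=[\bm{\mathfrak{a}}^\Psi_{ij}\ \bm{\mathfrak{b}}^\Psi_{ij}\ \bm{\mathfrak{c}}^\Psi_{ij}\ \bm{\mathfrak{d}}^\Psi_{ij}]\in\mathbb{R}^{N\times4}$ with $$\bm{\mathfrak{a}}^\Psi_{ij}=\Big(\bm{F}'(\bm{y}_i)\bm{f}(\bm{y}_j)\widetilde{\bm{V}}\bm{F}'(\bm{y}_i)+\mathrm{diag}(\widetilde{\bm{V}}^\top)\bm{F}''(\bm{y}_i)(1+\bm{f}(\bm{y}_i)^\top\bm{f}(\bm{y}_j))\Big)\bm{F}'(\bm{y}_j)\widetilde{\bm{V}}^\top,$$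 $$\bm{\mathfrak{b}}^\Psi_{ij}=\big(\bm{F}'(\bm{y}_i)^2+\bm{F}''(\bm{y}_i)\bm{F}(\bm{y}_i)\big)\bm{F}'(\bm{y}_j)\widetilde{\bm{V}}^\top,\qquad \bm{\mathfrak{c}}^\Psi_{ij}=\bm{F}''(\bm{y}_i)\bm{F}(\bm{y}_j)\bm{F}'(\bm{y}_j)\widetilde{\bm{V}}^\top,\qquad \bm{\mathfrak{d}}^\Psi_{ij}=\bm{F}''(\bm{y}_i)\bm{f}'(\bm{y}_j).$$
   Context: Network. Let $M,N,I\ge 1$ be integers and $f:\mathbb{R}\to\mathbb{R}$ a three times differentiable activation function with derivatives $f',f'',f'''$. For $\bm{y}\in\mathbb{R}^N$: $\bm{f}(\bm{y})=[f(y_1),\dots,f(y_N)]^\top$, and $\bm{f}',\bm{f}'',\bm{f}'''$ are defined entrywise in the same way; $\bm{F}(\bm{y}),\bm{F}'(\bm{y}),\bm{F}''(\bm{y}),\bm{F}'''(\bm{y})$ are the $N\times N$ diagonal matrices with diagonals $\bm{f}(\bm{y}),\bm{f}'(\bm{y}),\bm{f}''(\bm{y}),\bm{f}'''(\bm{y})$. For a vector $\bm{u}$, $\bm{h}(\bm{u})=[1\ \ \bm{u}^\top]^\top$. Parameters: $\bm{W}=[\bm{b}\ \ \widetilde{\bm{W}}]\in\mathbb{R}^{N\times(M+1)}$ with $\bm{b}\in\mathbb{R}^N$, $\widetilde{\bm{W}}\in\mathbb{R}^{N\times M}$, and $\bm{V}=[c\ \ \widetilde{\bm{V}}]\in\mathbb{R}^{1\times(N+1)}$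 with $c\in\mathbb{R}$, $\widetilde{\bm{V}}\in\mathbb{R}^{1\times N}$. Let $\bm{w}\in\mathbb{R}^{(M+1)N}$ be the vertical concatenation of the columns of $\bm{W}$ (in order), $\bm{v}=\bm{V}^\top\in\mathbb{R}^{N+1}$, and $\bm{\theta}=[\bm{w}^\top\ \bm{v}^\top]^\top\in\mathbb{R}^D$, $D=MN+2N+1$. For training data $\bm{x}_i\in\mathbb{R}^M$ with labels $q_i\in\{0,1\}$, $i=1,\dots,I$, put $\bm{y}_i=\bm{W}\bm{h}(\bm{x}_i)$, $z_i=\bm{V}\bm{h}(\bm{f}(\bm{y}_i))$, $p_i=s(z_i)$, where $s(z)=1/(1+e^{-z})$; then $s'(z_i)=p_i(1-p_i)$, $s''(z_i)=(1-2p_i)(1-p_i)p_i$; and $\delta_i=p_i-q_i$. Loss: $L(\bm{\theta})=-\sum_{i=1}^I\big(q_i\log p_i+(1-q_i)\log(1-p_i)\big)$. $\bm{H}_L(\bm{\theta})\in\mathbb{R}^{D\times D}$ is the Hessian of $L$ with respect to $\bm{\theta}$. Auxiliary quantities: $\bm{o}_i=[s'(z_i)\ \ \delta_i]^\top$, $\bm{s}^{\prime\prime/\prime}(z)=[s''(z)\ \ s'(z)]^\top$. The $2\times2$ matrix $\bm{\Phi}_{ij}$ has entries $(\bm{\Phi}_{ij})_{11}=(\widetilde{\bm{V}}\bm{F}'(\bm{y}_j)\bm{F}'(\bm{y}_i)\widetilde{\bm{V}}^\top)^2$, $(\bm{\Phi}_{ij})_{12}=\widetilde{\bm{V}}\bm{F}'(\bm{y}_i)\mathrm{diag}(\widetilde{\bm{V}}^\top)\bm{F}''(\bm{y}_j)\bm{F}'(\bm{y}_i)\widetilde{\bm{V}}^\top$,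 $(\bm{\Phi}_{ij})_{21}=\widetilde{\bm{V}}\bm{F}'(\bm{y}_j)\mathrm{diag}(\widetilde{\bm{V}}^\top)\bm{F}''(\bm{y}_i)\bm{F}'(\bm{y}_j)\widetilde{\bm{V}}^\top$, $(\bm{\Phi}_{ij})_{22}=\widetilde{\bm{V}}\bm{F}''(\bm{y}_i)\bm{F}''(\bm{y}_j)\widetilde{\bm{V}}^\top$; and $(\bm{\Phi}_{ij})_{11}^{1/2}$ denotes $\widetilde{\bm{V}}\bm{F}'(\bm{y}_j)\bm{F}'(\bm{y}_i)\widetilde{\bm{V}}^\top$ (with its sign). The $2\times2$ matrix $\bm{\Psi}_{ij}$ has entries $(\bm{\Psi}_{ij})_{11}=(1+\bm{f}(\bm{y}_i)^\top\bm{f}(\bm{y}_j))\widetilde{\bm{V}}\bm{F}'(\bm{y}_j)\bm{F}'(\bm{y}_i)\widetilde{\bm{V}}^\top$, $(\bm{\Psi}_{ij})_{12}=\bm{f}(\bm{y}_i)^\top\bm{F}'(\bm{y}_j)\bm{F}'(\bm{y}_i)\widetilde{\bm{V}}^\top$, $(\bm{\Psi}_{ij})_{21}=\widetilde{\bm{V}}\bm{F}'(\bm{y}_j)\bm{F}'(\bm{y}_i)\bm{f}(\bm{y}_j)$, $(\bm{\Psi}_{ij})_{22}=\bm{f}'(\bm{y}_i)^\top\bm{f}'(\bm{y}_j)$. The gradient of a scalar function is the column vector of its partial derivatives; $\otimes$ is the Kronecker product, and $\widetilde{\bm{V}}^{\odot k\top}$ is the column vector of entrywise $k$-th powers of $\widetilde{\bm{V}}^\top$.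 *)

(* Defs.v *)
From mathcomp Require Import all_boot all_order all_algebra.
From mathcomp Require Import all_classical all_reals all_analysis.

Set Implicit Arguments.
Unset Strict Implicit.
Unset Printing Implicit Defensive.

Import Order.TTheory GRing.Theory Num.Theory.
Import numFieldNormedType.Exports.

Local Open Scope ring_scope.
Local Open Scope classical_set_scope.

Section Calculus.
Context {R : realType}.

Definition three_times_differentiable (f : R -> R) : Prop :=
  [/\ forall y, derivable f y 1,
      forall y, derivable f^`(1) y 1
    & forall y, derivable f^`(2) y 1].

Definition partial n (F : 'cV[R]_n -> R) (k : 'I_n) (t : 'cV[R]_n) : R :=
  'D_(delta_mx k 0) F t.

Definition hessian n (F : 'cV[R]_n -> R) (t : 'cV[R]_n) : 'M[R]_n :=
  \matrix_(k, l) partial (partial F l) k t.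

Definition is_gradient n (F : 'cV[R]_n -> R) (t g : 'cV[R]_n) : Prop :=
  forall k, is_derive t (delta_mx k 0 : 'cV[R]_n) F (g k 0).

End Calculus.

Section LinearAlgebra.
Context {R : comNzRingType}.

Lemma mxvec_index_val m n (i : 'I_m) (j : 'I_n) :
  mxvec_index i j = (i * n + j)%N :> nat.
Proof.
rewrite /= /enum_rank [@enum_rank_in]unlock insubdK; last first.
  by rewrite -topredE /= cardE index_mem mem_enum.
rewrite enumT unlock /= /prod_enum.
suff gen (s : seq 'I_m) : i \in s ->
    index (i, j) [seq (a, b) | a <- s, b <- enum 'I_n] = (index i s * n + j)%N.
  by rewrite gen ?mem_enum// index_enum_ord.
elim: s => // a s IHs; rewrite inE /= index_cat.
have [->|ne_ai] := eqVneq a i.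
  by rewrite map_f ?mem_enum// index_map ?index_enum_ord// => ? ? [].
rewrite orFb => /IHs ->.
case: mapP => [[b _ [eia _]]|_]; first by rewrite eia eqxx in ne_ai.
by rewrite size_map size_enum_ord mulSn addnA.
Qed.

(* [mxvec] is row-major, hence the transposition to stack columns. *)
Definition vec m n (A : 'M[R]_(m, n)) : 'cV[R]_(n * m) := (mxvec A^T)^T.

Definition unvec m n (w : 'cV[R]_(n * m)) : 'M[R]_(m, n) := (vec_mx w^T)^T.

Lemma vecE m n (A : 'M[R]_(m, n)) (i : 'I_m) (j : 'I_n)
    (k : 'I_(n * m)) :
  k = (j * m + i)%N :> nat -> vec A k 0 = A i j.
Proof.
move=> kE; have -> : k = mxvec_index j i
  by apply: val_inj; apply: etrans kE (esym (mxvec_index_val _ _)).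
by rewrite mxE mxvecE mxE.
Qed.

Lemma vecK m n : cancel (@vec m n) (@unvec m n).
Proof. by move=> A; rewrite /vec /unvec trmxK mxvecK trmxK. Qed.

Lemma unvecK m n : cancel (@unvec m n) (@vec m n).
Proof. by move=> w; rewrite /vec /unvec trmxK vec_mxK trmxK. Qed.

(* Kronecker product of column vectors: the row-major reading of [u *m v^T]
   is the stacking of the blocks [u i 0 *: v]. *)
Definition kron m n (u : 'cV[R]_m) (v : 'cV[R]_n) : 'cV[R]_(m * n) :=
  (mxvec (u *m v^T))^T.

Lemma kronE m n (u : 'cV[R]_m) (v : 'cV[R]_n) (i : 'I_m) (j : 'I_n)
    (k : 'I_(m * n)) :
  k = (i * n + j)%N :> nat -> kron u v k 0 = u i 0 * v j 0.
Proof.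
move=> kE; have -> : k = mxvec_index i j
  by apply: val_inj; apply: etrans kE (esym (mxvec_index_val _ _)).
by rewrite mxE mxvecE mxE big_ord1 mxE.
Qed.

Definition hvec n (u : 'cV[R]_n) : 'cV[R]_(1 + n) := col_mx 1%:M u.

Definition scalar_of (A : 'M[R]_1) : R := A 0 0.

Definition dotv n (u v : 'cV[R]_n) : R := scalar_of (u^T *m v).

Definition diagv n (u : 'cV[R]_n) : 'M[R]_n := diag_mx u^T.

Definition powv n (u : 'rV[R]_n) (k : nat) : 'cV[R]_n :=
  (map_mx (fun a => a ^+ k) u)^T.

Definition vec2 (a b : R) : 'cV[R]_2 :=
  col_mx (a%:M : 'M[R]_1) (b%:M : 'M[R]_1).

Definition mx2 (a b c d : R) : 'M[R]_2 :=
  block_mx (a%:M : 'M[R]_1) (b%:M : 'M[R]_1) (c%:M : 'M[R]_1) (d%:M : 'M[R]_1).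

Definition cols4 n (a b c d : 'cV[R]_n) : 'M[R]_(n, 4) :=
  row_mx a (row_mx b (row_mx c d)).

End LinearAlgebra.

Section Network.
Context {R : realType} (f : R -> R) {M N I : nat}.
Context (x : 'I_I -> 'cV[R]_M) (q : 'I_I -> bool).
Context (theta : 'cV[R]_((1 + M) * N + (1 + N))).
Implicit Types i j : 'I_I.

Definition paramW : 'M[R]_(N, 1 + M) := unvec (usubmx theta).

Definition paramV : 'rV[R]_(1 + N) := (dsubmx theta)^T.

(* [paramV] is the row [c  Vtilde]. *)
Definition Vtilde : 'rV[R]_N := rsubmx paramV.

Definition sigmoid (a : R) : R := (1 + expR (- a))^-1.

Definition yv i : 'cV[R]_N := paramW *m hvec (x i).

(* [fv n i] and [Fm n i] use the [n]-th derivative of [f]; in particular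
   [fv 0 i] is the vector of activations. *)
Definition fv (n : nat) i : 'cV[R]_N := map_mx f^`(n) (yv i).

Definition Fm (n : nat) i : 'M[R]_N := diagv (fv n i).

Definition zv i : R := scalar_of (paramV *m hvec (map_mx f (yv i))).

Definition pv i : R := sigmoid (zv i).

Definition residual i : R := pv i - (q i)%:R.

Definition loss : R :=
  - \sum_(i < I) ((q i)%:R * ln (pv i) + (1 - (q i)%:R) * ln (1 - pv i)).

Definition sd (n : nat) i : R := (sigmoid^`(n))%classic (zv i).

Definition ovec i : 'cV[R]_2 := vec2 (sd 1 i) (residual i).

Definition svec i : 'cV[R]_2 := vec2 (sd 2 i) (sd 1 i).

Definition Phi11_sqrt i j : R :=
  scalar_of (Vtilde *m Fm 1 j *m Fm 1 i *m Vtilde^T).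

Definition Phi i j : 'M[R]_2 :=
  mx2 (Phi11_sqrt i j ^+ 2)
      (scalar_of (Vtilde *m Fm 1 i *m diagv Vtilde^T *m Fm 2 j *m Fm 1 i
                    *m Vtilde^T))
      (scalar_of (Vtilde *m Fm 1 j *m diagv Vtilde^T *m Fm 2 i *m Fm 1 j
                    *m Vtilde^T))
      (scalar_of (Vtilde *m Fm 2 i *m Fm 2 j *m Vtilde^T)).

Definition Psi i j : 'M[R]_2 :=
  mx2 ((1 + dotv (fv 0 i) (fv 0 j))
         * scalar_of (Vtilde *m Fm 1 j *m Fm 1 i *m Vtilde^T))
      (scalar_of ((fv 0 i)^T *m Fm 1 j *m Fm 1 i *m Vtilde^T))
      (scalar_of (Vtilde *m Fm 1 j *m Fm 1 i *m fv 0 j))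
      (dotv (fv 1 i) (fv 1 j)).

Definition aPhi i j : 'cV[R]_N :=
  (2 * Phi11_sqrt i j) *: (Fm 2 i *m Fm 1 j *m powv Vtilde 2).

Definition bPhi i j : 'cV[R]_N :=
  2 *: (Fm 1 i *m Fm 2 i *m Fm 2 j *m powv Vtilde 3).

Definition cPhi i j : 'cV[R]_N := Fm 3 i *m (Fm 1 j ^+ 2) *m powv Vtilde 3.

Definition dPhi i j : 'cV[R]_N := Fm 3 i *m Fm 2 j *m powv Vtilde 2.

Definition GPhi i j : 'M[R]_(N, 4) :=
  cols4 (aPhi i j) (bPhi i j) (cPhi i j) (dPhi i j).

Definition aPsi i j : 'cV[R]_N :=
  (Fm 1 i *m fv 0 j *m Vtilde *m Fm 1 i
   + (1 + dotv (fv 0 i) (fv 0 j)) *: (diagv Vtilde^T *m Fm 2 i))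
    *m Fm 1 j *m Vtilde^T.

Definition bPsi i j : 'cV[R]_N :=
  (Fm 1 i ^+ 2 + Fm 2 i *m Fm 0 i) *m Fm 1 j *m Vtilde^T.

Definition cPsi i j : 'cV[R]_N := Fm 2 i *m Fm 0 j *m Fm 1 j *m Vtilde^T.

Definition dPsi i j : 'cV[R]_N := Fm 2 i *m fv 1 j.

Definition GPsi i j : 'M[R]_(N, 4) :=
  cols4 (aPsi i j) (bPsi i j) (cPsi i j) (dPsi i j).

Definition APhi i j : 'cV[R]_N :=
  (1 + dotv (x i) (x j)) ^+ 2 *: (GPhi i j *m kron (ovec i) (ovec j)).

Definition APsi i j : 'cV[R]_N :=
  (2 * (1 + dotv (x i) (x j))) *: (GPsi i j *m kron (ovec i) (ovec j)).

Definition AOmega i j : 'cV[R]_N :=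
  ((1 + dotv (fv 0 i) (fv 0 j)) ^+ 2 * sd 2 i * sd 1 j)
    *: (Fm 1 i *m Vtilde^T).

Definition BPhi i j : 'cV[R]_N :=
  (1 + dotv (x i) (x j)) ^+ 2
    *: (Fm 1 i *m Vtilde^T *m (svec i)^T *m Phi i j *m ovec j).

Definition BPsi i j : 'cV[R]_N :=
  (2 * (1 + dotv (x i) (x j)))
    *: (Fm 1 i *m Vtilde^T *m (svec i)^T *m Psi i j *m ovec j).

Definition BOmega i j : 'cV[R]_N :=
  (2 * sd 1 i * sd 1 j * (1 + dotv (fv 0 i) (fv 0 j))) *: (Fm 1 i *m fv 0 j).

Definition WPhi i j : 'cV[R]_N := APhi i j + BPhi i j.

Definition WPsi i j : 'cV[R]_N := APsi i j + BPsi i j.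

Definition WOmega i j : 'cV[R]_N := AOmega i j + BOmega i j.

End Network.

(* Main.v *)
(* The pre-activations y_(i,n) and the output weights V_n are linear in theta,
   with constant gradients Y_(i,n) and e_n satisfying
   Y_(i,n) . Y_(j,m) = (1 + x_i . x_j) [n = m] and e_n . e_m = [n = m], both
   families being mutually orthogonal and orthogonal to the gradient of c.
   The Hessian of the loss is sum_i s'(z_i) u_i u_i^T + delta_i Q_i, where u_i
   and Q_i, the gradient and Hessian of z_i, are combinations of the Y_(i,n),
   the e_n and their outer products.  Expanding tr(H^2) with the Gram relations
   gives a double sum over (i, j) whose term depends on w only through y_i and
   y_j.  The (i, j) term being symmetric, its derivative through y_j is the one
   of the (j, i) term through y_i: this is the factor 2 of the gradient. *)

Require Import Defs.
From mathcomp Require Import all_boot all_order all_algebra.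
From mathcomp Require Import all_classical all_reals all_analysis.
From mathcomp Require Import ring.

Set Implicit Arguments.
Unset Strict Implicit.
Unset Printing Implicit Defensive.

Import Order.TTheory GRing.Theory Num.Theory.
Import numFieldNormedType.Exports.

Local Open Scope ring_scope.
Local Open Scope classical_set_scope.

(** * Rules for directional derivatives of real-valued functions *)

(** The two difference quotients coincide. One-variable results, in particular the chain rule, thus
    transfer to directional derivatives in parameter space, with no appeal to total
    differentiability. *)
Lemma is_derive_line (R : realType) (U : normedModType R) (F : U -> R) t v d :
  is_derive t v F d <-> is_derive (0 : R) 1 (fun h : R => F (h *: v + t)) d.
Proof.
have E : 'D_v F t = 'D_1 (fun h : R => F (h *: v + t)) 0.
  rewrite /derive; set g1 := (fun h => h^-1 *: _).
  set g2 := (fun h => h^-1 *: _).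
  suff -> : g1 = g2 by []; apply/funext => h; rewrite /g1 /g2 /=.
  by rewrite addr0 scale0r add0r [_%:A]mulr1.
have P := derivable1P F t v.
split=> -[dF <-]; split; [exact: P.1|exact/esym|exact: P.2|exact: E].
Qed.

Lemma is_derive_comp (R : realType) (U : normedModType R) (g : R -> R)
    (F : U -> R) t v dg d :
  is_derive (F t) 1 g dg -> is_derive t v F d ->
  is_derive t v (fun s => g (F s)) (dg * d).
Proof.
move=> Dg /is_derive_line DF; apply/is_derive_line.
by apply: (@is_derive1_comp _ g) => //=; rewrite scale0r add0r.
Qed.

(** The rules are restated for functions written pointwise, with values in [R], so that a derivative
    can be built as a single term following the shape of the expression. *)
Lemma is_derive_add (R : realType) (U : normedModType R) (F G : U -> R)
    t v d e :
  is_derive t v F d -> is_derive t v G e ->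
  is_derive t v (fun s => F s + G s) (d + e).
Proof. exact: is_deriveD. Qed.

Lemma is_derive_sub (R : realType) (U : normedModType R) (F G : U -> R)
    t v d e :
  is_derive t v F d -> is_derive t v G e ->
  is_derive t v (fun s => F s - G s) (d - e).
Proof. exact: is_deriveB. Qed.

Lemma is_derive_mul (R : realType) (U : normedModType R) (F G : U -> R)
    t v d e :
  is_derive t v F d -> is_derive t v G e ->
  is_derive t v (fun s => F s * G s) (d * G t + F t * e).
Proof.
move=> DF DG; have := is_deriveM DF DG.
by move/is_derive_eq; apply; rewrite /= addrC [_ *: _]mulrC.
Qed.

Lemma is_derive_bigsum (R : realType) (U : normedModType R) n
    (F : 'I_n -> U -> R) t v (d : 'I_n -> R) :
  (forall i, is_derive t v (F i) (d i)) ->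
  is_derive t v (fun s => \sum_i F i s) (\sum_i d i).
Proof.
move=> DF; have := is_derive_sum DF; congr is_derive.
by apply/funext => s; rewrite fct_sumE.
Qed.

Lemma is_derive_coord (R : realType) n (k l : 'I_n) (t : 'cV[R]_n) :
  is_derive t (delta_mx l 0) (fun s : 'cV[R]_n => s k 0) (k == l)%:R.
Proof.
apply/is_derive_line.
rewrite [X in is_derive _ _ X _](_ : _ = fun h => h * (k == l)%:R + t k 0);
  last by apply/funext => h; rewrite !mxE eqxx andbT.
have := is_derive_add
  (is_derive_mul (is_derive_id (0 : R) 1)
                 (is_derive_cst ((k == l)%:R : R) (0 : R) 1))
  (is_derive_cst (t k 0) (0 : R) 1).
by move/is_derive_eq; apply; rewrite mulr0 !addr0 mul1r.
Qed.

(** * The logistic function and the cross-entropy *)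

Section Sigmoid.
Variable R : realType.
Implicit Types a : R.

Lemma sigmoid_gt0 a : 0 < sigmoid a.
Proof. by rewrite invr_gt0 addr_gt0 ?expR_gt0. Qed.

Lemma sigmoid_lt1 a : sigmoid a < 1.
Proof. by rewrite invf_lt1 ?ltrDl ?addr_gt0 ?expR_gt0. Qed.

Lemma is_derive_sigmoid a :
  is_derive a 1 sigmoid (sigmoid a * (1 - sigmoid a)).
Proof.
have e0 : 1 + expR (- a) != 0 by rewrite gt_eqF ?addr_gt0 ?expR_gt0.
have De : is_derive a 1 (fun b : R => 1 + expR (- b)) (0 + expR (- a) * (- 1)).
  by apply: is_derive_add; apply: is_derive_comp.
have := @is_deriveV _ (fun b : R => 1 + expR (- b)) _ _ _ e0 De.
move/is_derive_eq; apply.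
rewrite /sigmoid /GRing.scale/=; field.
exact: e0.
Qed.

Lemma derive1_sigmoid : sigmoid^`(1) = fun a => sigmoid a * (1 - sigmoid a).
Proof.
apply/funext => a; rewrite derive1n1 derive1E.
by case: (is_derive_sigmoid a).
Qed.

Lemma is_derive_sigmoid1 a : is_derive a 1 sigmoid (sigmoid^`(1) a).
Proof. by rewrite derive1_sigmoid; exact: is_derive_sigmoid. Qed.

(** The second derivative stays unexpanded: the first one is a polynomial in [sigmoid], hence
    derivable, and this is enough. *)
Lemma is_derive_sigmoid2 a : is_derive a 1 sigmoid^`(1) (sigmoid^`(2) a).
Proof.
rewrite (derive1nS _ 1) derive1E; apply: derivableP; rewrite derive1_sigmoid.
have Ds := is_derive_sigmoid a.
by have [] := is_derive_mul (G := fun c => 1 - sigmoid c) Ds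
  (is_derive_sub (is_derive_cst (1 : R) a 1) Ds).
Qed.

(** The factor s (1 - s) of the logistic derivative cancels the denominators of both logarithms,
    leaving b (1 - s) - (1 - b) s = b - s. The bounds 0 < s < 1 make the logarithms
    differentiable. *)
Lemma is_derive_cross_entropy (b : bool) a :
  is_derive a 1
    (fun c => b%:R * ln (sigmoid c) + (1 - b%:R) * ln (1 - sigmoid c))
    (b%:R - sigmoid a).
Proof.
have s0 := sigmoid_gt0 a; have s1 := sigmoid_lt1 a.
have Ds := is_derive_sigmoid a.
have D1 := is_derive_comp (is_derive1_ln s0) Ds.
have s1' : 0 < 1 - sigmoid a by rewrite subr_gt0.
have D2 := is_derive_comp (F := fun c => 1 - sigmoid c) (is_derive1_ln s1')
  (is_derive_sub (is_derive_cst (1 : R) a 1) Ds).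
have := is_derive_add (is_derive_mul (is_derive_cst (b%:R : R) a 1) D1)
  (is_derive_mul (is_derive_cst (1 - b%:R : R) a 1) D2).
move/is_derive_eq; apply; rewrite /= ?fctE; field.
by rewrite !gt_eqF.
Qed.

End Sigmoid.

(** * Dot products, Kronecker products and rank-one matrices *)

Section DotProduct.
Variable K : comNzRingType.

Lemma dotvE n (u v : 'cV[K]_n) : dotv u v = \sum_k u k 0 * v k 0.
Proof. by rewrite /dotv /scalar_of mxE; apply: eq_bigr => k _; rewrite mxE. Qed.

Lemma dotvC n (u v : 'cV[K]_n) : dotv u v = dotv v u.
Proof. by rewrite !dotvE; apply: eq_bigr => k _; rewrite mulrC. Qed.

Lemma dotvDr n (u v w : 'cV[K]_n) : dotv u (v + w) = dotv u v + dotv u w.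
Proof. by rewrite /dotv /scalar_of mulmxDr mxE. Qed.

Lemma dotvZr n a (u v : 'cV[K]_n) : dotv u (a *: v) = a * dotv u v.
Proof. by rewrite /dotv /scalar_of -scalemxAr mxE. Qed.

Lemma dotv_sumr n m (u : 'cV[K]_n) (F : 'I_m -> 'cV[K]_n) :
  dotv u (\sum_i F i) = \sum_i dotv u (F i).
Proof. by rewrite /dotv /scalar_of mulmx_sumr summxE. Qed.

Lemma dotv0r n (u : 'cV[K]_n) : dotv u 0 = 0.
Proof. by rewrite /dotv /scalar_of mulmx0 mxE. Qed.

Lemma dotv_deltar n (u : 'cV[K]_n) k : dotv u (delta_mx k 0) = u k 0.
Proof. by rewrite /dotv /scalar_of -colE !mxE. Qed.

Lemma dotv_col_mx m n (u u' : 'cV[K]_m) (v v' : 'cV[K]_n) :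
  dotv (col_mx u v) (col_mx u' v') = dotv u u' + dotv v v'.
Proof. by rewrite /dotv /scalar_of tr_col_mx mul_row_col mxE. Qed.

Lemma kron_indexE m n (u : 'cV[K]_m) (v : 'cV[K]_n) i j :
  kron u v (mxvec_index i j) 0 = u i 0 * v j 0.
Proof. by apply: kronE; rewrite mxvec_index_val. Qed.

Lemma dotv_kron m n (u u' : 'cV[K]_m) (v v' : 'cV[K]_n) :
  dotv (kron u v) (kron u' v') = dotv u u' * dotv v v'.
Proof.
rewrite !dotvE mulr_suml; under [RHS]eq_bigr do rewrite mulr_sumr.
rewrite pair_bigA/= (reindex _ (curry_mxvec_bij _ _))/=.
by apply: eq_bigr => -[i j] _; rewrite /= !kron_indexE mulrACA.
Qed.

Lemma dotv_outer n (u v a b : 'cV[K]_n) :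
  dotv u (a *m b^T *m v) = dotv u a * dotv b v.
Proof. by rewrite /dotv /scalar_of -mulmxA mulmxA mxE big_ord1. Qed.

(** Cyclicity of the trace: a product with a rank-one matrix is traced by evaluating a bilinear
    form. *)
Lemma mxtrace_outer n (a b : 'cV[K]_n) (A : 'M[K]_n) :
  \tr (a *m b^T *m A) = dotv b (A *m a).
Proof. by rewrite -mulmxA mxtrace_mulC -mulmxA /mxtrace big_ord1. Qed.

End DotProduct.

(** * The trace of the squared Hessian from Gram relations alone *)

Section TraceSquare.
Variables (K : comNzRingType) (I N D : nat) (X : 'I_I -> 'I_I -> K).
Variables (Y : 'I_I -> 'I_N -> 'cV[K]_D) (e : 'I_N -> 'cV[K]_D) (c : 'cV[K]_D).
Hypothesis YY : forall i j n m, dotv (Y i n) (Y j m) = X i j * (n == m)%:R.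
Hypothesis ee : forall n m, dotv (e n) (e m) = (n == m)%:R.
Hypothesis Ye : forall i n m, dotv (Y i n) (e m) = 0.
Hypothesis Yc : forall i n, dotv (Y i n) c = 0.
Hypothesis ec : forall n, dotv (e n) c = 0.
Hypothesis cc : dotv c c = 1.
Variables a b p r : 'I_I -> 'I_N -> K.
Variables s d : 'I_I -> K.

(** Abstract gradient and Hessian of z_i. In the network, [a] is f(y), [b] is V f'(y), [p] is f'(y)
    and [r] is V f''(y), while [s] is s'(z) and [d] the residual. *)
Let u i : 'cV[K]_D := c + \sum_n (a i n *: e n + b i n *: Y i n).
Let Q i : 'M[K]_D := \sum_n (p i n *: (e n *m (Y i n)^T + Y i n *m (e n)^T)
                             + r i n *: (Y i n *m (Y i n)^T)).

(* [n] only ensures that [N] is positive, so that [YY] determines [X]. *)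
Let XC i j : forall n : 'I_N, X i j = X j i.
Proof. by move=> n; have := dotvC (Y i n) (Y j n); rewrite !YY eqxx !mulr1. Qed.

Let sum_delta (F : 'I_N -> K) n : \sum_m F m * (n == m)%:R = F n.
Proof.
rewrite (bigD1 n)//= eqxx mulr1 big1 ?addr0// => m.
by rewrite eq_sym => /negbTE ->; rewrite mulr0.
Qed.

(** Among the terms of [u j], only the one in [Y j n] is not orthogonal to [Y i n]. *)
Let dotYu i j n : dotv (Y i n) (u j) = X i j * b j n.
Proof.
rewrite dotvDr Yc add0r dotv_sumr -(sum_delta (fun m => X i j * b j m)).
by apply: eq_bigr => m _; rewrite dotvDr !dotvZr Ye YY mulr0 add0r mulrCA mulrA.
Qed.

Let dotYe i n m : dotv (e m) (Y i n) = 0.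
Proof. by rewrite dotvC Ye. Qed.

Let doteu j n : dotv (e n) (u j) = a j n.
Proof.
rewrite dotvDr ec add0r dotv_sumr -[RHS](sum_delta (a j)).
by apply: eq_bigr => m _; rewrite dotvDr !dotvZr dotYe ee mulr0 addr0.
Qed.

Let dotuu i j :
  dotv (u i) (u j) = 1 + \sum_n a i n * a j n + X i j * \sum_n b i n * b j n.
Proof.
rewrite {2}/u dotvDr dotvC {1}/u dotvDr cc dotv_sumr big1 => [|n _]; last first.
  by rewrite dotvDr !dotvZr ![dotv c _]dotvC Yc ec !mulr0 addr0.
rewrite addr0 dotv_sumr -addrA; congr (1 + _); rewrite mulr_sumr -big_split/=.
apply: eq_bigr => n _; rewrite dotvDr !dotvZr ![dotv (u i) _]dotvC dotYu doteu.
by rewrite (XC i j n); ring.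
Qed.

Let formQ i v w : dotv v (Q i *m w) = \sum_n
  (p i n * (dotv v (e n) * dotv (Y i n) w + dotv v (Y i n) * dotv (e n) w)
   + r i n * (dotv v (Y i n) * dotv (Y i n) w)).
Proof.
rewrite mulmx_suml dotv_sumr; apply: eq_bigr => n _.
by rewrite mulmxDl -!scalemxAl mulmxDl !(dotvDr, dotvZr) !dotv_outer.
Qed.

(** Each pairing of [u i] with some [Y j n] brings one factor [X i j]: two for the [r] terms, one
    for the [p] terms. The latter count twice because e Y^T and Y e^T take the same value on
    [u i]. *)
Let uQu i j : dotv (u i) (Q j *m u i) =
  X i j ^+ 2 * (\sum_n r j n * b i n ^+ 2)
  + 2 * X i j * \sum_n p j n * b i n * a i n.
Proof.
rewrite formQ !mulr_sumr -big_split/=; apply: eq_bigr => n _.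
by rewrite ![dotv (u i) _]dotvC dotYu doteu (XC j i n); ring.
Qed.

(** Each rank-one piece of [Q i] turns the trace into a bilinear form of [Q j] evaluated at [e n]
    and [Y i n]. The two mixed evaluations single out [p j n], and the one with [Y i n] on both
    sides singles out [r j n]. *)
Let traceQQ i j : \tr (Q i *m Q j) =
  X i j ^+ 2 * (\sum_n r i n * r j n) + 2 * X i j * \sum_n p i n * p j n.
Proof.
rewrite mulmx_suml raddf_sum !mulr_sumr -big_split/=; apply: eq_bigr => n _.
rewrite mulmxDl -!scalemxAl mulmxDl mxtraceD !mxtraceZ mxtraceD !mxtrace_outer.
have eQY : dotv (e n) (Q j *m Y i n) = X i j * p j n.
  rewrite formQ -(sum_delta (fun m => X i j * p j m)); apply: eq_bigr => m _.
  rewrite ee !dotYe YY (XC j i m) [m == n]eq_sym.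
  by case: (n == m) => /=; ring.
have YQe : dotv (Y i n) (Q j *m e n) = X i j * p j n.
  rewrite formQ -(sum_delta (fun m => X i j * p j m)); apply: eq_bigr => m _.
  rewrite ee !Ye YY [m == n]eq_sym.
  by case: (n == m) => /=; ring.
have YQY : dotv (Y i n) (Q j *m Y i n) = X i j ^+ 2 * r j n.
  rewrite formQ -(sum_delta (fun m => X i j ^+ 2 * r j m)).
  apply: eq_bigr => m _.
  rewrite dotYe !Ye !YY (XC j i m) [m == n]eq_sym.
  by case: (n == m) => /=; ring.
by rewrite eQY YQe YQY; ring.
Qed.

(** The four kinds of terms come from expanding the product: the squared dot product of [u i] and
    [u j], the form [Q j] at [u i], the form [Q i] at [u j], and the trace of [Q i *m Q j]. *)
Lemma mxtrace_hessian_sqr (H : 'M[K]_D) :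
  H = \sum_i (s i *: (u i *m (u i)^T) + d i *: Q i) ->
  \tr (H ^+ 2) = \sum_i \sum_j
    (s i * s j *
       (1 + \sum_n a i n * a j n + X i j * \sum_n b i n * b j n) ^+ 2
     + s i * d j * (X i j ^+ 2 * (\sum_n r j n * b i n ^+ 2)
                    + 2 * X i j * \sum_n p j n * b i n * a i n)
     + d i * s j * (X j i ^+ 2 * (\sum_n r i n * b j n ^+ 2)
                    + 2 * X j i * \sum_n p i n * b j n * a j n)
     + d i * d j * (X i j ^+ 2 * (\sum_n r i n * r j n)
                    + 2 * X i j * \sum_n p i n * p j n)).
Proof.
move=> ->; rewrite expr2 -[_ * _]/(_ *m _) mulmx_suml raddf_sum/=.
apply: eq_bigr => i _; rewrite mulmx_sumr raddf_sum/=; apply: eq_bigr => j _.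
rewrite mulmxDl !mulmxDr -!scalemxAl -!scalemxAr !mxtraceD !mxtraceZ.
rewrite !mxtrace_outer traceQQ uQu [\tr (Q i *m _)]mxtrace_mulC mxtrace_outer.
rewrite uQu dotv_outer [dotv (u j) _]dotvC dotuu.
by ring.
Qed.

End TraceSquare.

(** * Small block matrices and entrywise rules *)

Section SmallMatrices.
Variable K : comNzRingType.

(** The column-stacking identity: the dot product of u kron v with vec(W) is v^T W u. It exhibits
    each pre-activation as a linear form in the stacked weights. *)
Lemma dotv_kronl m n (u : 'cV[K]_n) (v : 'cV[K]_m) (w : 'cV[K]_(n * m)) :
  dotv (kron u v) w = dotv v (unvec w *m u).
Proof.
rewrite !dotvE; under [RHS]eq_bigr do rewrite mxE mulr_sumr.
rewrite exchange_big pair_bigA/= (reindex _ (curry_mxvec_bij _ _))/=.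
apply: eq_bigr => -[i j] _; rewrite /= kron_indexE !mxE.
by rewrite -mulrA mulrCA [u i 0 * _]mulrC.
Qed.

Lemma kron_vec2 (a b c d : K) : kron (vec2 a b) (vec2 c d) =
  col_mx (a * c)%:M (col_mx (a * d)%:M
    (col_mx (b * c)%:M (b * d)%:M)) :> 'cV[K]_(1 + (1 + (1 + 1))).
Proof.
apply/matrixP => k l; rewrite (ord1 l) {l}.
(* The four positions k = 2 i + j are treated one by one; comparing indices as natural numbers lets
   k be read in both the product and the block format. *)
have E (i j : 'I_2) : k = (i * 2 + j)%N :> nat ->
    kron (vec2 a b) (vec2 c d) k 0 = vec2 a b i 0 * vec2 c d j 0.
  by move=> kE; exact: (@kronE K 2 2 (vec2 a b) (vec2 c d) i j k kE).
case: k E => -[|[|[|[|//]]]] k4 E; [rewrite (E 0 0)|rewrite (E 0 1)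
  |rewrite (E 1 0)|rewrite (E 1 1)] => //; rewrite !mxE;
  do !(case: splitP => // -[] [|[|[|?]]] ? //= _; rewrite ?mxE//=).
Qed.

Lemma mul_cols4_kron n (a b c d : 'cV[K]_n) (o1 o2 o1' o2' : K) :
  cols4 a b c d *m kron (vec2 o1 o2) (vec2 o1' o2') =
  (o1 * o1') *: a + (o1 * o2') *: b + (o2 * o1') *: c + (o2 * o2') *: d.
Proof.
(* The dimension 4 is rewritten as nested sums of ones, the format in which block multiplication
   applies. *)
transitivity (row_mx a (row_mx b (row_mx c d)) *m
  (col_mx (o1 * o1')%:M (col_mx (o1 * o2')%:M
    (col_mx (o2 * o1')%:M (o2 * o2')%:M)) : 'cV[K]_(1 + (1 + (1 + 1))))).
  by rewrite -kron_vec2.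
rewrite !mul_row_col !mul_mx_scalar.
by rewrite !addrA.
Qed.

Lemma mul_vec2_mx2_vec2 (a b c d p q r s : K) :
  (vec2 p q)^T *m mx2 a b c d *m vec2 r s =
  (p * a * r + p * b * s + q * c * r + q * d * s)%:M.
Proof.
transitivity ((col_mx p%:M q%:M : 'cV[K]_(1 + 1))^T
  *m block_mx a%:M b%:M c%:M d%:M
  *m (col_mx r%:M s%:M : 'cV[K]_(1 + 1))) => //.
rewrite tr_col_mx mul_row_block mul_row_col !tr_scalar_mx.
rewrite -!scalar_mxM -!raddfD -!scalar_mxM -raddfD; congr (_%:M).
by ring.
Qed.

(** Entry rules that open one operation at a chosen place and leave the other matrices folded. *)
Lemma addmxE m n (A B : 'M[K]_(m, n)) i j : (A + B) i j = A i j + B i j.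
Proof. by rewrite mxE. Qed.

Lemma scalemxE m n a (A : 'M[K]_(m, n)) i j : (a *: A) i j = a * A i j.
Proof. by rewrite mxE. Qed.

Lemma outerE n (a b : 'cV[K]_n) k l : (a *m b^T) k l = a k 0 * b l 0.
Proof. by rewrite mxE big_ord1 mxE. Qed.

Lemma scalar_of_mul n (u : 'rV[K]_n) (v : 'cV[K]_n) :
  scalar_of (u *m v) = \sum_k u 0 k * v k 0.
Proof. by rewrite /scalar_of mxE. Qed.

Lemma mul_diagvE m n (u : 'cV[K]_m) (A : 'M[K]_(m, n)) i j :
  (diagv u *m A) i j = u i 0 * A i j.
Proof. by rewrite mul_diag_mx !mxE. Qed.

End SmallMatrices.

Lemma is_derive_dotv (R : realType) n (a t : 'cV[R]_n) k :
  is_derive t (delta_mx k 0) (dotv a) (a k 0).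
Proof.
rewrite (_ : dotv a = fun s => \sum_l a l 0 * s l 0);
  last by apply/funext => s; rewrite dotvE.
have D l : is_derive t (delta_mx k 0) (fun s : 'cV[R]_n => a l 0 * s l 0)
    (0 * t l 0 + a l 0 * (l == k)%:R).
  exact: is_derive_mul (is_derive_cst _ _ _) (is_derive_coord _ _ _).
apply: is_derive_eq (is_derive_bigsum D) _.
rewrite (bigD1 k)//= eqxx mul0r add0r mulr1 big1 ?addr0// => l /negbTE ->.
by rewrite mul0r mulr0 addr0.
Qed.

(** * The gradient and Hessian of the loss *)

Section Network.
Variables (R : realType) (f : R -> R) (M N I : nat).
Hypothesis hf : three_times_differentiable f.
Variables (x : 'I_I -> 'cV[R]_M) (q : 'I_I -> bool).
Local Notation params := 'cV[R]_((1 + M) * N + (1 + N)).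
Implicit Types (t : params) (i j : 'I_I) (n : 'I_N).

Definition grad_y i n : params :=
  col_mx (kron (hvec (x i)) (delta_mx n 0)) 0.

Definition grad_V n : params := col_mx 0 (col_mx 0 (delta_mx n 0)).

Definition grad_c : params := col_mx 0 (col_mx 1%:M 0).

Lemma yvE t i n : yv x t i n 0 = dotv (grad_y i n) t.
Proof.
rewrite -[t in RHS]vsubmxK dotv_col_mx dotv_kronl [dotv _ (dsubmx _)]dotvC.
by rewrite dotv0r addr0 dotvC dotv_deltar.
Qed.

Lemma VtildeE t n : Vtilde t 0 n = dotv (grad_V n) t.
Proof.
rewrite -[t in RHS]vsubmxK -[dsubmx t]vsubmxK !dotv_col_mx.
by rewrite ![dotv _ (usubmx _)]dotvC !dotv0r !add0r dotvC dotv_deltar !mxE.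
Qed.

Lemma zvE t i : zv f x t i =
  dotv grad_c t + \sum_n Vtilde t 0 n * f (yv x t i n 0).
Proof.
have -> : dotv grad_c t = dotv 1%:M (usubmx (dsubmx t)).
  rewrite -[t in LHS]vsubmxK -[dsubmx t in LHS]vsubmxK !dotv_col_mx.
  rewrite [dotv 0 (usubmx _)]dotvC [dotv 0 (dsubmx _)]dotvC !dotv0r.
  by rewrite add0r addr0.
(* [paramV] is the transpose of the lower block of [t], so z_i is a dot product by conversion. *)
rewrite -[zv _ _ _ _]/(dotv (dsubmx t) (hvec _)).
rewrite -[dsubmx t in LHS]vsubmxK dotv_col_mx dotvC; congr (_ + _).
by rewrite dotvE; apply: eq_bigr => n _; rewrite !mxE.
Qed.

Lemma is_derive_yv t k i n :
  is_derive t (delta_mx k 0) (fun s => yv x s i n 0) (grad_y i n k 0).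
Proof.
rewrite (_ : (fun s => _) = dotv (grad_y i n)); first exact: is_derive_dotv.
by apply/funext => s; rewrite yvE.
Qed.

Lemma is_derive_Vtilde t k n :
  is_derive t (delta_mx k 0) (fun s : params => Vtilde s 0 n) (grad_V n k 0).
Proof.
rewrite (_ : (fun s => _) = dotv (grad_V n)); first exact: is_derive_dotv.
by apply/funext => s; rewrite VtildeE.
Qed.

(** The bound on [l] reflects three-fold differentiability: the derivatives of [f] of order 0, 1 and
    2 are themselves derivable. *)
Lemma is_derive_fv t k l i n : (l <= 2)%N ->
  is_derive t (delta_mx k 0) (fun s => derive1n l f (yv x s i n 0))
    (derive1n l.+1 f (yv x t i n 0) * grad_y i n k 0).
Proof.
move=> l2; apply: is_derive_comp; last exact: is_derive_yv.
case: hf => f1 f2 f3; rewrite derive1nS derive1E; apply: derivableP.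
by case: l l2 => [|[|[|l]]] l2; [exact: f1|exact: f2|exact: f3|discriminate l2].
Qed.

Definition grad_z t i : params := grad_c +
  \sum_n (f (yv x t i n 0) *: grad_V n
          + (Vtilde t 0 n * derive1n 1 f (yv x t i n 0)) *: grad_y i n).

Definition hess_z t i : 'M[R]_((1 + M) * N + (1 + N)) :=
  \sum_n (derive1n 1 f (yv x t i n 0) *: (grad_V n *m (grad_y i n)^T
                                    + grad_y i n *m (grad_V n)^T)
          + (Vtilde t 0 n * derive1n 2 f (yv x t i n 0)) *:
              (grad_y i n *m (grad_y i n)^T)).

Lemma is_derive_zv t k i :
  is_derive t (delta_mx k 0) (zv f x ^~ i) (grad_z t i k 0).
Proof.
rewrite (_ : zv f x ^~ i = fun s => dotv grad_c s
  + \sum_n Vtilde s 0 n * f (yv x s i n 0)); last first.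
  by apply/funext => s; rewrite zvE.
rewrite addmxE summxE; apply: is_derive_add; first exact: is_derive_dotv.
apply: is_derive_bigsum => n.
apply: is_derive_eq.
  exact: is_derive_mul (is_derive_Vtilde t k n) (@is_derive_fv t k 0 i n isT).
by rewrite addmxE !scalemxE derive1n0; ring.
Qed.

(** The two mixed outer products have different origins: Y e^T comes from differentiating the
    coefficient f(y) of [grad_V], and e Y^T from differentiating the factor V in the coefficient of
    [grad_y]. *)
Lemma is_derive_grad_z t k l i :
  is_derive t (delta_mx k 0) (fun s => grad_z s i l 0) (hess_z t i k l).
Proof.
rewrite (_ : (fun s => _) = fun s => grad_c l 0
  + \sum_n (f (yv x s i n 0) * grad_V n l 0
     + Vtilde s 0 n * derive1n 1 f (yv x s i n 0) * grad_y i n l 0));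
  last first.
  apply/funext => s; rewrite addmxE summxE; congr (_ + _).
  by apply: eq_bigr => n _; rewrite addmxE !scalemxE.
have D n := is_derive_add
  (is_derive_mul (@is_derive_fv t k 0 i n isT)
    (is_derive_cst (grad_V n l 0) t (delta_mx k 0)))
  (is_derive_mul (is_derive_mul (is_derive_Vtilde t k n)
                                (@is_derive_fv t k 1 i n isT))
    (is_derive_cst (grad_y i n l 0) t (delta_mx k 0))).
apply: is_derive_eq.
  exact: is_derive_add (is_derive_cst (grad_c l 0) _ _) (is_derive_bigsum D).
rewrite add0r summxE; apply: eq_bigr => n _.
rewrite addmxE !scalemxE addmxE !outerE derive1n0 /cst.
by ring.
Qed.

Lemma is_derive_pv t k i : is_derive t (delta_mx k 0)
  (fun s => pv f x s i) (sd f x t 1 i * grad_z t i k 0).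
Proof. exact: is_derive_comp (is_derive_sigmoid1 _) (is_derive_zv _ _ _). Qed.

Lemma is_derive_residual t k i : is_derive t (delta_mx k 0)
  (fun s => residual f x q s i) (sd f x t 1 i * grad_z t i k 0).
Proof.
rewrite -[X in is_derive _ _ _ X]subr0.
by apply: is_derive_sub (is_derive_pv t k i) _; exact: is_derive_cst.
Qed.

Lemma is_derive_sd1 t k i : is_derive t (delta_mx k 0)
  (fun s => sd f x s 1 i) (sd f x t 2 i * grad_z t i k 0).
Proof. exact: is_derive_comp (is_derive_sigmoid2 _) (is_derive_zv _ _ _). Qed.

Lemma partial_loss l : partial (loss f x q) l =
  fun t => \sum_i residual f x q t i * grad_z t i l 0.
Proof.
apply/funext => t; rewrite /partial.
have D i := is_derive_comp (F := zv f x ^~ i)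
  (is_derive_cross_entropy (q i) (zv f x t i))
  (is_derive_zv t l i).
have [_ ->] := is_deriveN (is_derive_bigsum D).
by rewrite -sumrN; apply: eq_bigr => i _; rewrite -mulNr opprB.
Qed.

(** Product rule on residual times gradient of z_i: the residual has derivative s'(z_i) times that
    gradient, which gives the rank-one (Gauss-Newton) part; the other factor gives the
    residual-weighted Hessian of z_i. *)
Lemma hessian_loss t : hessian (loss f x q) t =
  \sum_i (sd f x t 1 i *: (grad_z t i *m (grad_z t i)^T)
          + residual f x q t i *: hess_z t i).
Proof.
apply/matrixP => k l; rewrite mxE partial_loss /partial.
have D i := is_derive_mul (is_derive_residual t k i) (is_derive_grad_z t k l i).
have [_ ->] := is_derive_bigsum D.
rewrite [RHS]summxE; apply: eq_bigr => i _.
by rewrite [RHS]addmxE scalemxE outerE [in RHS]scalemxE mulrA.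
Qed.

End Network.

(** * The trace as a double sum, and the closed form in coordinates *)

Section TraceGradient.
Variables (R : realType) (f : R -> R) (M N I : nat).
Hypothesis hf : three_times_differentiable f.
Variables (x : 'I_I -> 'cV[R]_M) (q : 'I_I -> bool).
Local Notation params := 'cV[R]_((1 + M) * N + (1 + N)).
Implicit Types (t : params) (i j : 'I_I) (n : 'I_N).

Local Notation V t n := (Vtilde t 0 n).
Local Notation act l t i n := (derive1n l f (yv x t i n 0)).
Local Notation X i j := (dotv (hvec (x i)) (hvec (x j))).

Lemma dotv_hvec i j : X i j = 1 + dotv (x i) (x j).
Proof. by rewrite dotv_col_mx dotvE big_ord1 !mxE mulr1. Qed.

(** Dot products of Kronecker products factor, here into that of the inputs and that of the basis
    vectors. *)
Lemma dotv_grad_y i j n m :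
  dotv (grad_y x i n) (grad_y x j m) = X i j * (n == m)%:R.
Proof.
rewrite dotv_col_mx dotv0r addr0 dotv_kron dotv_deltar mxE eqxx andbT.
by rewrite [m == n]eq_sym.
Qed.

Lemma dotv_grad_V n m : dotv (grad_V R M n) (grad_V R M m) = (n == m)%:R.
Proof.
rewrite !dotv_col_mx !dotv0r !add0r dotv_deltar mxE eqxx andbT.
by rewrite [m == n]eq_sym.
Qed.

Lemma dotv_grad_yV i n m : dotv (grad_y x i n) (grad_V R M m) = 0.
Proof. by rewrite dotv_col_mx dotv0r dotvC dotv0r addr0. Qed.

Lemma dotv_grad_yc i n : dotv (grad_y x i n) (grad_c R M N) = 0.
Proof. by rewrite dotv_col_mx dotv0r dotvC dotv0r addr0. Qed.

Lemma dotv_grad_Vc n : dotv (grad_V R M n) (grad_c R M N) = 0.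
Proof. by rewrite !dotv_col_mx dotv0r dotvC !dotv0r !addr0. Qed.

Lemma dotv_grad_cc : dotv (grad_c R M N) (grad_c R M N) = 1.
Proof.
by rewrite !dotv_col_mx !dotv0r addr0 add0r dotvE big_ord1 !mxE eqxx mulr1.
Qed.

(* [sum_f] is 1 + f(y_i)^T f(y_j); [sum_Phi11] is the signed square root of the
   entry of Phi; the (2, 1) entries of Phi and Psi are the (1, 2) entries with
   [i] and [j] exchanged, and [sum_f * sum_Phi11] is the (1, 1) entry of Psi. *)
Definition sum_f t i j := 1 + \sum_n f (yv x t i n 0) * f (yv x t j n 0).
Definition sum_Phi11 t i j :=
  \sum_n (V t n * act 1 t i n) * (V t n * act 1 t j n).
Definition sum_Phi12 t i j :=
  \sum_n (V t n * act 2 t j n) * (V t n * act 1 t i n) ^+ 2.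
Definition sum_Phi22 t i j :=
  \sum_n (V t n * act 2 t i n) * (V t n * act 2 t j n).
Definition sum_Psi12 t i j :=
  \sum_n act 1 t j n * (V t n * act 1 t i n) * f (yv x t i n 0).
Definition sum_Psi22 t i j := \sum_n act 1 t i n * act 1 t j n.

(** Arranged exactly as the summand of [mxtrace_hessian_sqr], so that the general formula applies by
    conversion. Exchanging [i] and [j] swaps the two middle terms. *)
Definition pair_term t i j :=
  let s := sd f x t 1 in let d := residual f x q t in
  s i * s j * (sum_f t i j + X i j * sum_Phi11 t i j) ^+ 2
  + s i * d j * (X i j ^+ 2 * sum_Phi12 t i j + 2 * X i j * sum_Psi12 t i j)
  + d i * s j * (X j i ^+ 2 * sum_Phi12 t j i + 2 * X j i * sum_Psi12 t j i)
  + d i * d j * (X i j ^+ 2 * sum_Phi22 t i j + 2 * X i j * sum_Psi22 t i j).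

Lemma mxtrace_hessian_loss_sqr t :
  \tr (hessian (loss f x q) t ^+ 2) = \sum_i \sum_j pair_term t i j.
Proof.
apply: (mxtrace_hessian_sqr dotv_grad_y dotv_grad_V dotv_grad_yV dotv_grad_yc
  dotv_grad_Vc dotv_grad_cc); exact: hessian_loss.
Qed.

Lemma FmE l t i m (A : 'M[R]_(N, m)) n k :
  (Fm f x t l i *m A) n k = act l t i n * A n k.
Proof. by rewrite mul_diagvE mxE. Qed.

Lemma trVE t n : (Vtilde t)^T n 0 = V t n.
Proof. by rewrite mxE. Qed.

Lemma fvE l t i n : fv f x t l i n 0 = act l t i n.
Proof. by rewrite mxE. Qed.

Lemma mul_scalarE m (u : 'cV[R]_m) (A : 'M[R]_1) k :
  (u *m A) k 0 = u k 0 * scalar_of A.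
Proof. by rewrite mxE big_ord1. Qed.

Lemma scalar_ofK (a : R) : scalar_of a%:M = a.
Proof. by rewrite /scalar_of mxE eqxx. Qed.

Lemma Phi11_sqrtE t i j : Phi11_sqrt f x t i j = sum_Phi11 t i j.
Proof.
rewrite /Phi11_sqrt -!mulmxA scalar_of_mul; apply: eq_bigr => n _.
by rewrite 2!FmE trVE; ring.
Qed.

Lemma dotv_fvE t i j :
  1 + dotv (fv f x t 0 i) (fv f x t 0 j) = sum_f t i j.
Proof.
by congr (1 + _); rewrite dotvE; apply: eq_bigr => n _; rewrite 2!fvE.
Qed.

Lemma Phi12E t i j :
  scalar_of (Vtilde t *m Fm f x t 1 i *m diagv (Vtilde t)^T *m Fm f x t 2 j
               *m Fm f x t 1 i *m (Vtilde t)^T) = sum_Phi12 t i j.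
Proof.
rewrite -!mulmxA scalar_of_mul; apply: eq_bigr => n _.
by rewrite FmE mul_diagvE 2!FmE trVE; ring.
Qed.

Lemma Phi22E t i j :
  scalar_of (Vtilde t *m Fm f x t 2 i *m Fm f x t 2 j *m (Vtilde t)^T)
  = sum_Phi22 t i j.
Proof.
rewrite -!mulmxA scalar_of_mul; apply: eq_bigr => n _.
rewrite 2!FmE trVE.
move: (act 2 t i n) (act 2 t j n) (V t n) => a b c.
by ring.
Qed.

Lemma Psi12E t i j :
  scalar_of ((fv f x t 0 i)^T *m Fm f x t 1 j *m Fm f x t 1 i *m (Vtilde t)^T)
  = sum_Psi12 t i j.
Proof.
rewrite -!mulmxA scalar_of_mul; apply: eq_bigr => n _.
by rewrite 2!FmE trVE [_^T _ _]mxE fvE derive1n0; ring.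
Qed.

Lemma Psi21E t i j :
  scalar_of (Vtilde t *m Fm f x t 1 j *m Fm f x t 1 i *m fv f x t 0 j)
  = sum_Psi12 t j i.
Proof.
rewrite -!mulmxA scalar_of_mul; apply: eq_bigr => n _.
by rewrite 2!FmE fvE derive1n0; ring.
Qed.

Lemma Psi22E t i j : dotv (fv f x t 1 i) (fv f x t 1 j) = sum_Psi22 t i j.
Proof. by rewrite dotvE; apply: eq_bigr => n _; rewrite 2!fvE. Qed.

Lemma PhiE t i j : Phi f x t i j =
  mx2 (sum_Phi11 t i j ^+ 2) (sum_Phi12 t i j) (sum_Phi12 t j i)
      (sum_Phi22 t i j).
Proof.
apply: (f_equal4 mx2); first by rewrite Phi11_sqrtE.
- exact: Phi12E.
- exact: Phi12E.
- exact: Phi22E.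
Qed.

Lemma PsiE t i j : Psi f x t i j =
  mx2 (sum_f t i j * sum_Phi11 t i j) (sum_Psi12 t i j) (sum_Psi12 t j i)
      (sum_Psi22 t i j).
Proof.
apply: (f_equal4 mx2).
- by rewrite dotv_fvE; congr (_ * _); exact: Phi11_sqrtE.
- exact: Psi12E.
- exact: Psi21E.
- exact: Psi22E.
Qed.

Lemma powvE t k n : powv (Vtilde t) k n 0 = V t n ^+ k.
Proof. by rewrite mxE mxE. Qed.

Lemma mul_cols4_ovec t i j n (a b c d : 'cV[R]_N) :
  let s := sd f x t 1 in let e := residual f x q t in
  (cols4 a b c d *m kron (ovec f x q t i) (ovec f x q t j)) n 0 =
  s i * s j * a n 0 + s i * e j * b n 0 + e i * s j * c n 0
  + e i * e j * d n 0.
Proof. by rewrite mul_cols4_kron 3!addmxE 4!scalemxE. Qed.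

Lemma mul_svec_mx2_ovec t i j n (a b c d : R) :
  let s := sd f x t 1 in let e := residual f x q t in
  (Fm f x t 1 i *m (Vtilde t)^T *m (svec f x t i)^T *m mx2 a b c d
     *m ovec f x q t j) n 0 =
  act 1 t i n * V t n *
  (sd f x t 2 i * a * s j + sd f x t 2 i * b * e j + s i * c * s j
   + s i * d * e j).
Proof.
rewrite -!mulmxA FmE mul_scalarE trVE !mulmxA mul_vec2_mx2_vec2 scalar_ofK.
by rewrite mulrA.
Qed.

(** All matrices applied are diagonal or of rank one, so a coordinate of the closed form is a
    polynomial in scalars, ready for comparison by [ring]. The first summand is the A part, the
    second the B part; the next two lemmas do the same for Psi and Omega. *)
Lemma WPhiE t i j n : WPhi f x q t i j n 0 =
  let s := sd f x t 1 in let d := residual f x q t in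
  let s2 := sd f x t 2 i in let F l i := act l t i n in
  X i j ^+ 2 *
    (s i * s j * (2 * sum_Phi11 t i j * (F 2 i * (F 1 j * V t n ^+ 2)))
     + s i * d j * (2 * (F 1 i * (F 2 i * (F 2 j * V t n ^+ 3))))
     + d i * s j * (F 3 i * (F 1 j * (F 1 j * V t n ^+ 3)))
     + d i * d j * (F 3 i * (F 2 j * V t n ^+ 2)))
  + X i j ^+ 2 *
    (F 1 i * V t n *
     (s2 * sum_Phi11 t i j ^+ 2 * s j + s2 * sum_Phi12 t i j * d j
        + s i * sum_Phi12 t j i * s j + s i * sum_Phi22 t i j * d j)).
Proof.
have aE : aPhi f x t i j n 0 =
    2 * sum_Phi11 t i j * (act 2 t i n * (act 1 t j n * V t n ^+ 2)).
  by rewrite /aPhi scalemxE -!mulmxA 2!FmE powvE Phi11_sqrtE.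
have bE : bPhi f x t i j n 0 =
    2 * (act 1 t i n * (act 2 t i n * (act 2 t j n * V t n ^+ 3))).
  by rewrite /bPhi scalemxE -!mulmxA 3!FmE powvE.
have cE : cPhi f x t i j n 0 =
    act 3 t i n * (act 1 t j n * (act 1 t j n * V t n ^+ 3)).
  by rewrite /cPhi expr2 -[_ * _]/(_ *m _) -!mulmxA 3!FmE powvE.
have dE : dPhi f x t i j n 0 = act 3 t i n * (act 2 t j n * V t n ^+ 2).
  by rewrite /dPhi -!mulmxA 2!FmE powvE.
rewrite /WPhi addmxE /APhi /BPhi 2!scalemxE mul_cols4_ovec aE bE cE dE.
by rewrite PhiE mul_svec_mx2_ovec dotv_hvec.
Qed.

Lemma WPsiE t i j n : WPsi f x q t i j n 0 =
  let s := sd f x t 1 in let d := residual f x q t in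
  let s2 := sd f x t 2 i in
  let F0 i := f (yv x t i n 0) in let F l i := act l t i n in
  2 * X i j *
    (s i * s j * (F 1 i * F0 j * sum_Phi11 t i j
                  + sum_f t i j * (V t n * (F 2 i * (F 1 j * V t n))))
     + s i * d j * (F 1 i * (F 1 i * (F 1 j * V t n))
                    + F 2 i * (F0 i * (F 1 j * V t n)))
     + d i * s j * (F 2 i * (F0 j * (F 1 j * V t n)))
     + d i * d j * (F 2 i * F 1 j))
  + 2 * X i j *
    (F 1 i * V t n *
       (s2 * (sum_f t i j * sum_Phi11 t i j) * s j + s2 * sum_Psi12 t i j * d j
        + s i * sum_Psi12 t j i * s j + s i * sum_Psi22 t i j * d j)).
Proof.
have aE : aPsi f x t i j n 0 =
    act 1 t i n * f (yv x t j n 0) * sum_Phi11 t i j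
    + sum_f t i j * (V t n * (act 2 t i n * (act 1 t j n * V t n))).
  rewrite /aPsi !mulmxDl addmxE -2!scalemxAl scalemxE dotv_fvE.
  rewrite -!mulmxA (FmE 1 t i) (mul_scalarE (fv f x t 0 j)) fvE.
  rewrite (mul_diagvE (Vtilde t)^T) 2!FmE trVE !mulmxA.
  (* The diagonal factors come in the opposite order to [Phi11_sqrt f x t i j]: this is the same
     quantity with [i] and [j] exchanged, and it is symmetric. *)
  have -> : scalar_of (Vtilde t *m Fm f x t 1 i *m Fm f x t 1 j
      *m (Vtilde t)^T) = sum_Phi11 t i j.
    rewrite -[LHS]/(Phi11_sqrt f x t j i) Phi11_sqrtE.
    by apply: eq_bigr => k _; rewrite mulrC.
  by rewrite derive1n0 mulrA.
have bE : bPsi f x t i j n 0 =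
    act 1 t i n * (act 1 t i n * (act 1 t j n * V t n))
    + act 2 t i n * (f (yv x t i n 0) * (act 1 t j n * V t n)).
  rewrite /bPsi expr2 -[_ * _]/(_ *m _) 2!mulmxDl addmxE -!mulmxA 6!FmE trVE.
  by rewrite derive1n0.
have cE : cPsi f x t i j n 0 =
    act 2 t i n * (f (yv x t j n 0) * (act 1 t j n * V t n)).
  by rewrite /cPsi -!mulmxA 3!FmE trVE derive1n0.
have dE : dPsi f x t i j n 0 = act 2 t i n * act 1 t j n.
  by rewrite /dPsi FmE fvE.
rewrite /WPsi addmxE /APsi /BPsi 2!scalemxE mul_cols4_ovec aE bE cE dE.
by rewrite PsiE mul_svec_mx2_ovec dotv_hvec.
Qed.

Lemma WOmegaE t i j n : WOmega f x t i j n 0 =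
  let s := sd f x t 1 in
  sum_f t i j ^+ 2 * sd f x t 2 i * s j * (act 1 t i n * V t n)
  + 2 * s i * s j * sum_f t i j * (act 1 t i n * f (yv x t j n 0)).
Proof.
rewrite /WOmega addmxE /AOmega /BOmega 2!scalemxE dotv_fvE 2!FmE trVE fvE.
by rewrite derive1n0.
Qed.

End TraceGradient.

(** * Derivatives along the input-to-hidden weights *)

Lemma is_derive_sqr (R : realType) (U : normedModType R) (F : U -> R) t v d :
  is_derive t v F d -> is_derive t v (fun s => F s ^+ 2) (2 * F t * d).
Proof.
move=> D; rewrite (_ : (fun s => _) = fun s => F s * F s).
  by apply: is_derive_eq (is_derive_mul D D) _; ring.
by apply/funext => s; rewrite expr2.
Qed.

(** The common factor [c] will be the Kronecker delta of the moving neuron. Keeping it outermost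
    through products and squares lets a sum over neurons collapse to one term. *)
Lemma is_derive_mul_scaled (R : realType) (U : normedModType R) (F G : U -> R)
    t v d e c :
  is_derive t v F (d * c) -> is_derive t v G (e * c) ->
  is_derive t v (fun s => F s * G s) ((d * G t + F t * e) * c).
Proof.
move=> DF DG; apply: is_derive_eq (is_derive_mul DF DG) _.
by rewrite mulrDl mulrAC mulrA.
Qed.

Lemma is_derive_sqr_scaled (R : realType) (U : normedModType R) (F : U -> R)
    t v d c :
  is_derive t v F (d * c) ->
  is_derive t v (fun s => F s ^+ 2) (2 * F t * d * c).
Proof.
by move=> DF; apply: is_derive_eq (is_derive_sqr DF) _; rewrite mulrA.
Qed.

Section InputDirections.
Variables (R : realType) (f : R -> R) (M N I : nat).
Hypothesis hf : three_times_differentiable f.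
Variables (x : 'I_I -> 'cV[R]_M) (q : 'I_I -> bool).
Local Notation params := 'cV[R]_((1 + M) * N + (1 + N)).
Implicit Types (i j : 'I_I) (n : 'I_N).
Variables (t : params) (m : 'I_(1 + M)) (n0 : 'I_N).

Local Notation V t n := (Vtilde t 0 n).
Local Notation act l t i n := (derive1n l f (yv x t i n 0)).
Local Notation X i j := (dotv (hvec (x i)) (hvec (x j))).
Local Notation h i := (hvec (x i) m 0).
Local Notation k := (lshift (1 + N) (mxvec_index m n0)).
Local Notation v := (delta_mx k 0 : params).

(** The direction [v] moves the single weight in row [n0] and column [m] of W. Hence for each input
    only the pre-activation of neuron [n0] moves, at rate [h i], and the output weights stay
    fixed. *)
Lemma grad_y_input i n : grad_y x i n k 0 = h i * (n0 == n)%:R.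
Proof. by rewrite col_mxEu kron_indexE [delta_mx _ _ _ _]mxE eqxx andbT. Qed.

Lemma grad_V_input n : grad_V R M n k 0 = 0.
Proof. by rewrite col_mxEu mxE. Qed.

Lemma grad_z_input i :
  grad_z f x t i k 0 = h i * (V t n0 * act 1 t i n0).
Proof.
rewrite addmxE col_mxEu mxE add0r summxE (bigD1 n0)//= big1 => [|n n0n].
  by rewrite addmxE 2!scalemxE grad_V_input grad_y_input eqxx mulr1; ring.
by rewrite addmxE 2!scalemxE grad_V_input grad_y_input [n0 == n]eq_sym
  (negbTE n0n) !mulr0 addr0.
Qed.

Lemma is_derive_act_input l i n : (l <= 2)%N ->
  is_derive t v (fun s => act l s i n)
    (h i * act l.+1 t i n * (n0 == n)%:R).
Proof.
move=> l2; apply: is_derive_eq (is_derive_fv hf x t k i n l2) _.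
by rewrite grad_y_input mulrCA mulrA.
Qed.

Lemma is_derive_Vact_input l i n : (l <= 2)%N ->
  is_derive t v (fun s => V s n * act l s i n)
    (V t n * (h i * act l.+1 t i n) * (n0 == n)%:R).
Proof.
move=> l2; apply: is_derive_eq (is_derive_mul (is_derive_Vtilde t k n)
  (@is_derive_act_input l i n l2)) _.
by rewrite grad_V_input mul0r add0r mulrA.
Qed.

Lemma is_derive_sum_input (F : 'I_N -> params -> R) (d : 'I_N -> R) :
  (forall n, is_derive t v (F n) (d n * (n0 == n)%:R)) ->
  is_derive t v (fun s => \sum_n F n s) (d n0).
Proof.
move=> D; apply: is_derive_eq (is_derive_bigsum D) _.
rewrite (bigD1 n0)//= eqxx mulr1 big1 ?addr0// => n.
by rewrite eq_sym => /negbTE ->; rewrite mulr0.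
Qed.

(** This derivative and the five that follow keep the shape given by the product rule;
    simplification is left to the final [ring]. *)
Lemma is_derive_sum_f i j : is_derive t v (fun s => sum_f f x s i j)
  (0 + (h i * act 1 t i n0 * f (yv x t j n0 0)
        + f (yv x t i n0 0) * (h j * act 1 t j n0))).
Proof.
rewrite /sum_f; apply: is_derive_add (is_derive_cst (1 : R) t v) _.
exact: (is_derive_sum_input (fun n => is_derive_mul_scaled
  (@is_derive_act_input 0 i n isT) (@is_derive_act_input 0 j n isT))).
Qed.

Lemma is_derive_sum_Phi11 i j : is_derive t v (fun s => sum_Phi11 f x s i j)
  (V t n0 * (h i * act 2 t i n0) * (V t n0 * act 1 t j n0)
   + V t n0 * act 1 t i n0 * (V t n0 * (h j * act 2 t j n0))).
Proof.
exact: (is_derive_sum_input (fun n => is_derive_mul_scaled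
  (@is_derive_Vact_input 1 i n isT) (@is_derive_Vact_input 1 j n isT))).
Qed.

Lemma is_derive_sum_Phi12 i j : is_derive t v (fun s => sum_Phi12 f x s i j)
  (V t n0 * (h j * act 3 t j n0) * (V t n0 * act 1 t i n0) ^+ 2
   + V t n0 * act 2 t j n0
     * (2 * (V t n0 * act 1 t i n0) * (V t n0 * (h i * act 2 t i n0)))).
Proof.
exact: (is_derive_sum_input (fun n => is_derive_mul_scaled
  (@is_derive_Vact_input 2 j n isT)
  (is_derive_sqr_scaled (@is_derive_Vact_input 1 i n isT)))).
Qed.

Lemma is_derive_sum_Phi22 i j : is_derive t v (fun s => sum_Phi22 f x s i j)
  (V t n0 * (h i * act 3 t i n0) * (V t n0 * act 2 t j n0)
   + V t n0 * act 2 t i n0 * (V t n0 * (h j * act 3 t j n0))).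
Proof.
exact: (is_derive_sum_input (fun n => is_derive_mul_scaled
  (@is_derive_Vact_input 2 i n isT) (@is_derive_Vact_input 2 j n isT))).
Qed.

Lemma is_derive_sum_Psi12 i j : is_derive t v (fun s => sum_Psi12 f x s i j)
  ((h j * act 2 t j n0 * (V t n0 * act 1 t i n0)
    + act 1 t j n0 * (V t n0 * (h i * act 2 t i n0))) * f (yv x t i n0 0)
   + act 1 t j n0 * (V t n0 * act 1 t i n0) * (h i * act 1 t i n0)).
Proof.
exact: (is_derive_sum_input (fun n => is_derive_mul_scaled
  (is_derive_mul_scaled (@is_derive_act_input 1 j n isT)
    (@is_derive_Vact_input 1 i n isT)) (@is_derive_act_input 0 i n isT))).
Qed.

Lemma is_derive_sum_Psi22 i j : is_derive t v (fun s => sum_Psi22 f x s i j)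
  (h i * act 2 t i n0 * act 1 t j n0 + act 1 t i n0 * (h j * act 2 t j n0)).
Proof.
exact: (is_derive_sum_input (fun n => is_derive_mul_scaled
  (@is_derive_act_input 1 i n isT) (@is_derive_act_input 1 j n isT))).
Qed.

Lemma sum_fC i j : sum_f f x t i j = sum_f f x t j i.
Proof. by congr (1 + _); apply: eq_bigr => n _; exact: mulrC. Qed.

Lemma sum_Phi11C i j : sum_Phi11 f x t i j = sum_Phi11 f x t j i.
Proof. by apply: eq_bigr => n _; exact: mulrC. Qed.

Lemma sum_Phi22C i j : sum_Phi22 f x t i j = sum_Phi22 f x t j i.
Proof. by apply: eq_bigr => n _; exact: mulrC. Qed.

Lemma sum_Psi22C i j : sum_Psi22 f x t i j = sum_Psi22 f x t j i.
Proof. by apply: eq_bigr => n _; exact: mulrC. Qed.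

Definition Wsum i j := WPhi f x q t i j + WPsi f x q t i j + WOmega f x t i j.

Lemma WE i j :
  Wsum i j n0 0 = WPhi f x q t i j n0 0 + WPsi f x q t i j n0 0
               + WOmega f x t i j n0 0.
Proof. by rewrite (addmxE (_ + _)) (addmxE (WPhi _ _ _ _ _ _)). Qed.

(** Along [v] the term varies through y_i at rate [h i] and through y_j at rate [h j]. After the
    product rule and the coordinate formulas for the W vectors, the claim is a polynomial
    identity. *)
Lemma is_derive_pair_term i j : is_derive t v (fun s => pair_term f x q s i j)
  (h i * Wsum i j n0 0 + h j * Wsum j i n0 0).
Proof.
have Ds i' := is_derive_sd1 hf x t k i'.
have Dd i' := is_derive_residual hf x q t k i'.
have Dc c := is_derive_cst (c : R) t v.
have D := is_derive_add (is_derive_add (is_derive_add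
  (is_derive_mul (is_derive_mul (Ds i) (Ds j)) (is_derive_sqr
    (is_derive_add (is_derive_sum_f i j)
       (is_derive_mul (Dc (X i j)) (is_derive_sum_Phi11 i j)))))
  (is_derive_mul (is_derive_mul (Ds i) (Dd j)) (is_derive_add
    (is_derive_mul (Dc (X i j ^+ 2)) (is_derive_sum_Phi12 i j))
    (is_derive_mul (Dc (2 * X i j)) (is_derive_sum_Psi12 i j)))))
  (is_derive_mul (is_derive_mul (Dd i) (Ds j)) (is_derive_add
    (is_derive_mul (Dc (X j i ^+ 2)) (is_derive_sum_Phi12 j i))
    (is_derive_mul (Dc (2 * X j i)) (is_derive_sum_Psi12 j i)))))
  (is_derive_mul (is_derive_mul (Dd i) (Dd j)) (is_derive_add
    (is_derive_mul (Dc (X i j ^+ 2)) (is_derive_sum_Phi22 i j))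
    (is_derive_mul (Dc (2 * X i j)) (is_derive_sum_Psi22 i j)))).
apply: is_derive_eq D _.
rewrite (grad_z_input i) (grad_z_input j) /cst (WE i j) (WE j i).
rewrite (WPhiE f x q t i j) (WPhiE f x q t j i) (WPsiE f x q t i j).
rewrite (WPsiE f x q t j i) (WOmegaE f x t i j) (WOmegaE f x t j i).
cbv zeta.
(* The symmetric quantities are all put in the order [i], [j], so that both halves share their
   atoms. The sums [sum_Phi12] and [sum_Psi12] keep both orders. *)
rewrite (dotvC (hvec (x j))) (sum_fC j i) (sum_Phi11C j i) (sum_Phi22C j i).
rewrite (sum_Psi22C j i).
(* Without this generalization, [ring] compares its atoms by unfolding them. *)
move: (act 1 t i n0) (act 2 t i n0) (act 3 t i n0) => a1 a2 a3.
move: (act 1 t j n0) (act 2 t j n0) (act 3 t j n0) => b1 b2 b3.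
move: (f (yv x t i n0 0)) (f (yv x t j n0 0)) (V t n0) => a0 b0 V0.
move: (sum_f f x t i j) (sum_Phi11 f x t i j) (sum_Phi22 f x t i j).
move=> F P11 P22.
move: (sum_Phi12 f x t i j) (sum_Phi12 f x t j i) => P12 P21.
move: (sum_Psi12 f x t i j) (sum_Psi12 f x t j i) (sum_Psi22 f x t i j).
move=> Q12 Q21 Q22.
move: (sd f x t 1 i) (sd f x t 1 j) (sd f x t 2 i) (sd f x t 2 j).
move=> s1 r1 s2 r2; move: (residual f x q t i) (residual f x q t j) => d e.
move: (X i j) (h i) (h j) => Xij hi hj.
by ring.
Qed.

End InputDirections.

(** * The gradient with respect to the input-to-hidden parameters *)

(** Moving w along a basis vector with the lower block frozen is moving the whole parameter vector
    along the shifted basis vector. A partial derivative in w is thus one in the full parameter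
    space. *)
Lemma col_mx_line (K : pzRingType) n1 n2 (a : K) (k : 'I_n1)
    (u : 'cV[K]_(n1 + n2)) :
  col_mx (a *: delta_mx k 0 + usubmx u) (dsubmx u)
  = a *: delta_mx (lshift n2 k) 0 + u.
Proof.
rewrite -[u in RHS]vsubmxK; apply/colP => l; rewrite -[l]splitK.
case: (fintype.split l) => [i|j] /=; rewrite [RHS]mxE [in RHS]mxE.
  by rewrite [delta_mx _ _ _ _]mxE eq_lshift !col_mxEu !mxE.
by rewrite [delta_mx _ _ _ _]mxE eq_rlshift /= mulr0 add0r !col_mxEd.
Qed.

Theorem theorem4 (R : realType) (M N I : nat)
  (hM : (1 <= M)%N) (hN : (1 <= N)%N) (hI : (1 <= I)%N)
  (f : R -> R) (hf : three_times_differentiable f)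
  (x : 'I_I -> 'cV[R]_M) (q : 'I_I -> bool)
  (theta : 'cV[R]_((1 + M) * N + (1 + N))) :
  is_gradient
    (fun w : 'cV[R]_((1 + M) * N) =>
       \tr (hessian (loss f x q) (col_mx w (dsubmx theta)) ^+ 2))
    (usubmx theta)
    (2 *: \sum_(i < I) \sum_(j < I)
       kron (hvec (x i))
         (WPhi f x q theta i j + WPsi f x q theta i j + WOmega f x theta i j)).
Proof.
(* A coordinate of w is the weight in row [n] and column [m] of W. *)
move=> k; case/mxvec_indexP: k => m n.
apply/is_derive_line.
rewrite (_ : (fun s : R => _) = fun s : R => \sum_i \sum_j
  pair_term f x q (s *: delta_mx (lshift _ (mxvec_index m n)) 0 + theta) i j).
  have /is_derive_line D := is_derive_bigsum (fun i =>
    is_derive_bigsum (fun j => is_derive_pair_term hf x q theta m n i j)).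
  apply: is_derive_eq D _.
  (* The double sum splits into an (i, j) half and a (j, i) half; exchanging the summations in the
     second makes the halves equal, whence the factor 2. *)
  under eq_bigr do rewrite big_split/=.
  rewrite big_split/= [X in _ + X]exchange_big/= -mulr2n -[LHS]mulr_natl.
  rewrite [RHS]scalemxE [in RHS]summxE; congr (_ * _); apply: eq_bigr => i _.
  by rewrite summxE; apply: eq_bigr => j _; rewrite kron_indexE.
by apply/funext => s; rewrite col_mx_line (mxtrace_hessian_loss_sqr hf).
Qed.
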